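(* Let $F:\mathbb{R}^d\to\mathbb{R}$ be $L$-smooth and bounded from below by $F^*\in\mathbb{R}$, and let $\nabla f(x,\xi)$ be a stochastic gradient oracle satisfying, for some $p\in(1,2]$ and $\sigma\in(0,\infty)$, $\mathbb{E}[\nabla f(x,\xi)]=\nabla F(x)$ and $\mathbb{E}[|\nabla f(x,\xi)|^p]\le\sigma^p$ for all $x\in\mathbb{R}^d$. Let $x_1\in\mathbb{R}^d$ with $\Delta_1:=F(x_1)-F^*>0$. For $T\in\mathbb{N}_{\ge1}$ let $\eta_t=1/(2L)$ for all $t$ and $$n=\left\lceil\max\left\{1,\left(\frac{\sigma^2T}{\Delta_1L}\right)^{\frac{p}{2(p-1)}}\right\}\right\rceil .$$ Then the iterates generated by PS-Clip-SGD with batch size $n$, step sizes $\eta_t$ and parameters $\alpha=\sigma$, $\beta=p$ satisfy $$\frac1T\sum_{t=1}^T\mathbb{E}\big(|\nabla F(x_t)|^2\big)\le 9\,\frac{\Delta_1L}{T}.$$ This corresponds to a sample complexity of $$O\!\left(\frac{\Delta_1L}{\varepsilon^2}+\frac{\Delta_1L}{\varepsilon^2}\left(\frac{\sigma}{\varepsilon}\right)^{\frac{p}{p-1}}\right)$$ to achieve $\frac1T\sum_{t=1}^T\mathbb{E}(|\nabla F(x_t)|^2)<\varepsilon^2$.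
   Context: $|\cdot|$ is the Euclidean norm on $\mathbb{R}^d$, $d\ge1$. $F$ is $L$-smooth ($L>0$) if it is differentiable and $|\nabla F(x)-\nabla F(y)|\le L|x-y|$ for all $x,y\in\mathbb{R}^d$. The stochastic gradient oracle is a (measurable) map $(x,\xi)\mapsto\nabla f(x,\xi)\in\mathbb{R}^d$, where $\xi$ is a random variable with distribution $\mathcal{D}$; expectations in the oracle assumptions are over $\xi\sim\mathcal{D}$. PS-Clip-SGD (per-sample clipped SGD) with parameters $\alpha,\beta>0$, batch size $n$ and step sizes $\eta_t>0$, started at the point $x_1$: at each iteration $t=1,\dots,T$ draw i.i.d. samples $\xi_t^{(1)},\dots,\xi_t^{(n)}\sim\mathcal{D}$, independent of the samples of all previous iterations (hence independent of $x_t$), and set $$G(x_t,\alpha,\beta)=\frac1n\sum_{k=1}^n\gamma_t^{(k)}\nabla f(x_t,\xi_t^{(k)}),\qquad \gamma_t^{(k)}=\min\Big\{1,\frac{\alpha k^{1/\beta}}{|\nabla f(x_t,\xi_t^{(k)})|}\Big\}$$ (with $\gamma_t^{(k)}=1$ if $\nabla f(x_t,\xi_t^{(k)})=0$), and $x_{t+1}=x_t-\eta_t G(x_t,\alpha,\beta)$. The sample complexity is the total number of stochastic gradients used, that is, $nT$ for $T$ iterations with batch size $n$. *)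

(* Defs.v *)
From mathcomp Require Export all_boot all_order all_algebra.
From mathcomp Require Export finmap.
From mathcomp Require Export all_classical all_reals all_analysis.
Export Order.TTheory GRing.Theory Num.Theory.
Export numFieldNormedType.Exports.

Set Implicit Arguments.
Unset Strict Implicit.
Unset Printing Implicit Defensive.

Local Open Scope classical_set_scope.
Local Open Scope ring_scope.

(* The library norm `|x| on 'rV[R]_d is the sup norm.  It induces the same
   topology and the same notion of differentiability as the Euclidean one. *)
Definition enorm (R : realType) (d : nat) (x : 'rV[R]_d) : R :=
  Num.sqrt (\sum_(i < d) x 0 i ^+ 2).

Definition grad (R : realType) (d : nat) (F : 'rV[R]_d -> R) (x : 'rV[R]_d) :
    'rV[R]_d :=
  \row_(i < d) 'D_(delta_mx 0 i) F x.

Definition L_smooth (R : realType) (d : nat) (L : R) (F : 'rV[R]_d -> R) :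
    Prop :=
  (forall x, differentiable F x) /\
  (forall x y, enorm (grad F x - grad F y) <= L * enorm (x - y)).

(* R^d with its Borel sigma-algebra. *)
Definition borel_rV (R : realType) (d : nat) :=
  g_sigma_algebraType (@open 'rV[R]_d).

(* The expectation of the vector-valued map [g x] is taken coordinatewise;
   equality with a real number forces each coordinate to be integrable. *)
Definition stochastic_gradient_oracle (R : realType) (d : nat)
    (F : 'rV[R]_d -> R) (dX : measure_display) (Xi : measurableType dX)
    (D : probability Xi R) (p sigma : R) (g : 'rV[R]_d -> Xi -> 'rV[R]_d) :
    Prop :=
  [/\ measurable_fun [set: borel_rV R d * Xi]
        (fun z => g z.1 z.2 : borel_rV R d),
      (forall x i, 'E_D[fun z => g x z 0%R i] = (grad F x 0%R i)%:E)%E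
    & (forall x, 'E_D[fun z => (enorm (g x z) `^ p)%R]
                 <= (sigma `^ p)%:E)%E].

Definition mutually_independent (R : realType) (dO dX : measure_display)
    (Omega : measurableType dO) (Xi : measurableType dX)
    (P : probability Omega R) (I : choiceType) (S : set I)
    (X : I -> {RV P >-> Xi}) : Prop :=
  forall (J : {fset I}) (A : I -> set Xi),
    [set` J] `<=` S ->
    (forall i, measurable (A i)) ->
    (P (\bigcap_(i in [set` J]) (X i @^-1` A i)) =
     \prod_(i <- J) P (X i @^-1` A i))%E.

(* Only the samples xi t k with 1 <= t <= T and 1 <= k <= n are constrained. *)
Definition iid_samples (R : realType) (dO dX : measure_display)
    (Omega : measurableType dO) (Xi : measurableType dX)
    (P : probability Omega R) (D : probability Xi R) (T n : nat)
    (xi : nat -> nat -> {RV P >-> Xi}) : Prop :=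
  (forall t k, (1 <= t <= T)%N -> (1 <= k <= n)%N ->
     forall A, measurable A -> distribution P (xi t k) A = D A) /\
  mutually_independent
    [set tk : nat * nat | (1 <= tk.1 <= T)%N && (1 <= tk.2 <= n)%N]
    (fun tk => xi tk.1 tk.2).

Definition clip_factor (R : realType) (d : nat) (alpha beta : R) (k : nat)
    (v : 'rV[R]_d) : R :=
  if v == 0 then 1
  else Num.min 1 (alpha * k%:R `^ (beta^-1) / enorm v).

Definition ps_clip_estimator (R : realType) (d : nat) (Xi : Type)
    (g : 'rV[R]_d -> Xi -> 'rV[R]_d) (alpha beta : R) (n : nat)
    (x : 'rV[R]_d) (z : nat -> Xi) : 'rV[R]_d :=
  n%:R^-1 *:
    \sum_(1 <= k < n.+1) clip_factor alpha beta k (g x (z k)) *: g x (z k).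

(* Times and batch indices start at 1; x 0 plays no role. *)
Definition ps_clip_sgd (R : realType) (d : nat) (Omega Xi : Type)
    (g : 'rV[R]_d -> Xi -> 'rV[R]_d) (alpha beta : R) (n : nat)
    (eta : nat -> R) (x1 : 'rV[R]_d) (T : nat)
    (xi : nat -> nat -> Omega -> Xi) (x : nat -> Omega -> 'rV[R]_d) : Prop :=
  (forall w, x 1%N w = x1) /\
  (forall t w, (1 <= t <= T)%N ->
     x t.+1 w = x t w -
       eta t *: ps_clip_estimator g alpha beta n (x t w) (fun k => xi t k w)).

Definition batch_size (R : realType) (p L sigma Delta1 : R) (T : nat) : nat :=
  `|Num.ceil (Num.max 1
      ((sigma ^+ 2 * T%:R / (Delta1 * L)) `^ (p / (2 * (p - 1)))))%R|%N.

Definition avg_sq_grad (R : realType) (d : nat) (dO : measure_display)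
    (Omega : measurableType dO) (P : probability Omega R)
    (F : 'rV[R]_d -> R) (T : nat) (x : nat -> Omega -> 'rV[R]_d) : \bar R :=
  ((T%:R^-1)%:E *
     \sum_(1 <= t < T.+1) 'E_P[fun w => (enorm (grad F (x t w)) ^+ 2)%R])%E.

(* Main.v *)
Require Import Defs.
From HB Require Import structures.
From mathcomp Require Import ring lra.
From mathcomp Require Import measurable_realfun.

(* With step 1/(2L) the descent lemma gives, for every realization,
   |grad F(x_t)|^2 <= 4L (F(x_t) - F(x_{t+1})) + |G_t - grad F(x_t)|^2, which
   telescopes before any expectation is taken, so that no integrability of
   F(x_t) is needed.  It remains to see that the error of the estimator has
   second moment at most 5 sigma^2 n^(2/p - 2), which is at most
   5 Delta_1 L / T by the choice of n.  The p-th moment bound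
   shows that clipping at level sigma k^(1/p) has bias at most
   sigma k^(1/p - 1) and second moment at most sigma^2 k^(2/p - 1).  Averaging
   over k, the squared bias contributes p^2 <= 4 and the variance 1.  The
   variances add up because, conditionally on the samples drawn before, a new
   sample still has law D: mutual independence extends from cylinders to the
   sigma-algebra they generate, and Tonelli's theorem integrates the new sample
   first. *)

Set Implicit Arguments.
Unset Strict Implicit.
Unset Printing Implicit Defensive.

Local Open Scope classical_set_scope.
Local Open Scope ring_scope.

(** * Euclidean norm and descent lemma *)

Definition dot (R : realType) (d : nat) (x y : 'rV[R]_d) : R :=
  \sum_(i < d) x 0 i * y 0 i.

Section euclidean.
Context {R : realType} {d : nat}.
Implicit Types (x y z : 'rV[R]_d) (a : R).

Lemma enorm_ge0 x : 0 <= enorm x.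
Proof. exact: sqrtr_ge0. Qed.

Lemma enorm_sqr x : enorm x ^+ 2 = \sum_(i < d) x 0 i ^+ 2.
Proof. by rewrite sqr_sqrtr// sumr_ge0// => i _; rewrite sqr_ge0. Qed.

Lemma enorm_dot x : enorm x ^+ 2 = dot x x.
Proof. by rewrite enorm_sqr; apply: eq_bigr => i _; rewrite expr2. Qed.

Lemma dotC x y : dot x y = dot y x.
Proof. by apply: eq_bigr => i _; rewrite mulrC. Qed.

Lemma dotDl x y z : dot (x + y) z = dot x z + dot y z.
Proof. by rewrite -big_split; apply: eq_bigr => i _; rewrite mxE mulrDl. Qed.

Lemma dotZl a x y : dot (a *: x) y = a * dot x y.
Proof. by rewrite mulr_sumr; apply: eq_bigr => i _; rewrite mxE mulrA. Qed.

Lemma dotDr x y z : dot z (x + y) = dot z x + dot z y.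
Proof. by rewrite dotC dotDl !(dotC z). Qed.

Lemma dotZr a x y : dot y (a *: x) = a * dot y x.
Proof. by rewrite dotC dotZl dotC. Qed.

Lemma dotNl x y : dot (- x) y = - dot x y.
Proof. by rewrite -scaleN1r dotZl mulN1r. Qed.

Lemma dotNr x y : dot y (- x) = - dot y x.
Proof. by rewrite dotC dotNl dotC. Qed.

Lemma enormZ a x : enorm (a *: x) = `|a| * enorm x.
Proof.
apply/eqP; rewrite -(eqrXn2 (n := 2))// ?mulr_ge0 ?enorm_ge0//.
by rewrite exprMn !enorm_dot dotZl dotZr real_normK ?num_real// expr2 mulrA.
Qed.

Lemma enorm_eq0 x : (enorm x == 0) = (x == 0).
Proof.
apply/eqP/eqP => [x0|->]; last first.
  by rewrite -(scale0r (0 : 'rV[R]_d)) enormZ normr0 mul0r.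
have /eqP : \sum_(i < d) x 0 i ^+ 2 = 0 by rewrite -enorm_sqr x0 expr0n.
rewrite psumr_eq0 => [/allP xi|i _]; last exact: sqr_ge0.
apply/rowP => i; rewrite mxE; apply/eqP.
by have := xi i (mem_index_enum i); rewrite /= sqrf_eq0.
Qed.

Lemma cauchy_schwarz x y : dot x y <= enorm x * enorm y.
Proof.
have [/eqP|y0] := boolP (enorm y == 0).
  move=> y0; rewrite y0 mulr0; move: y0 => /eqP; rewrite enorm_eq0 => /eqP ->.
  by rewrite -(scale0r (0 : 'rV[R]_d)) dotZr mul0r.
have [/eqP|x0] := boolP (enorm x == 0).
  move=> x0; rewrite x0 mul0r; move: x0 => /eqP; rewrite enorm_eq0 => /eqP ->.
  by rewrite -(scale0r (0 : 'rV[R]_d)) dotZl mul0r.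
have xgt0 : 0 < enorm x by rewrite lt_def x0 enorm_ge0.
have ygt0 : 0 < enorm y by rewrite lt_def y0 enorm_ge0.
(* Expanding this square gives 2|x||y| (|x||y| - <x, y>) >= 0, and the factor in front is
   positive. *)
have : 0 <= enorm (enorm y *: x - enorm x *: y) ^+ 2 by rewrite sqr_ge0.
rewrite enorm_dot !(dotDl, dotDr, dotNl, dotNr, dotZl, dotZr) -!enorm_dot.
rewrite (dotC y x) => h.
have : 0 <= (2 * (enorm x * enorm y)) * (enorm x * enorm y - dot x y) by lra.
by rewrite pmulr_rge0 ?subr_ge0// !mulr_gt0.
Qed.

Lemma enormD x y : enorm (x + y) <= enorm x + enorm y.
Proof.
rewrite -ler_sqr ?nnegrE ?addr_ge0 ?enorm_ge0// enorm_dot.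
rewrite dotDl !dotDr -!enorm_dot (dotC y x).
have := cauchy_schwarz x y; lra.
Qed.

Lemma enorm_sum (I : Type) (r : seq I) (P : pred I) (f : I -> 'rV[R]_d) :
  enorm (\sum_(i <- r | P i) f i) <= \sum_(i <- r | P i) enorm (f i).
Proof.
elim/big_ind2 : _ => [|x a y b xa yb|//].
  by have := enorm_eq0 (0 : 'rV[R]_d); rewrite eqxx => /eqP ->.
by rewrite (le_trans (enormD _ _))// lerD.
Qed.

Lemma le_coord_enorm x i : `|x 0 i| <= enorm x.
Proof.
rewrite -ler_sqr ?nnegrE ?enorm_ge0// real_normK ?num_real// enorm_sqr.
by rewrite (bigD1 i)//= lerDl sumr_ge0// => j _; rewrite sqr_ge0.
Qed.

End euclidean.

Section descent.
Context {R : realType} {d : nat} (F : 'rV[R]_d -> R).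
Hypothesis dF : forall x, differentiable F x.

Lemma derive_dot_grad x v : 'D_v F x = dot (grad F x) v.
Proof.
rewrite deriveE// [X in 'd F x X = _](row_sum_delta v) linear_sum.
apply: eq_bigr => i _; rewrite linearZ /= mxE deriveE//.
by rewrite mulrC.
Qed.

Lemma is_derive_segment x v (s : R) :
  is_derive s 1 (fun s : R => F (x + s *: v)) (dot (grad F (x + s *: v)) v).
Proof.
(* The difference quotient of [F] at x + s v along v is that of its restriction to the line, so
   derivability transfers. *)
have E : (fun h : R => h^-1 *: ((F \o shift (x + s *: v)) (h *: v) - F (x + s *: v)))
   = (fun h : R => h^-1 *: (((fun s : R => F (x + s *: v)) \o shift s) (h *: (1 : R))
        - F (x + s *: v))).
  apply/funext => h /=; congr (_ *: (F _ - _)).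
  by rewrite [h *: 1]mulr1 scalerDl addrCA.
have /derivableP : derivable F (x + s *: v) v by exact: diff_derivable.
rewrite derive_dot_grad => -[dv Dv].
split.
  by rewrite /derivable -E.
by rewrite -Dv /derive -E.
Qed.

(** [psi] is [F] on the segment minus its linear part at x and the quadratic bound. By
    Cauchy-Schwarz and the Lipschitz gradient its derivative is at most s L |v|^2 - s L |v|^2 = 0 on
    (0, 1), and psi 1 <= psi 0 is the claim. *)
Lemma smooth_upper_bound (L : R) x y : L_smooth L F ->
  F y <= F x + dot (grad F x) (y - x) + L / 2 * enorm (y - x) ^+ 2.
Proof.
move=> [_ LF]; set v := y - x.
pose psi (s : R) :=
  F (x + s *: v) - s * dot (grad F x) v - s ^+ 2 * (L / 2 * enorm v ^+ 2).
have dpsi (s : R) : is_derive s 1 psi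
    (dot (grad F (x + s *: v)) v - dot (grad F x) v - s * (L * enorm v ^+ 2)).
  have dF' := is_derive_segment x v s.
  rewrite /psi; apply: is_derive_eq; rewrite /= /GRing.scale/=; by field.
have : psi 1 <= psi 0.
  apply: (@ler0_derive1_nincr _ psi 0 1) => //.
  - move=> s; rewrite in_itv/= => /andP[s0 _].
    rewrite derive1E (@derive_val _ _ _ _ _ _ _ (dpsi s)) -dotNl -dotDl subr_le0.
    rewrite (le_trans (cauchy_schwarz _ _))//.
    rewrite (le_trans (ler_wpM2r (enorm_ge0 _) (LF _ _)))//.
    rewrite addrC addKr enormZ ger0_norm ?(ltW s0)//.
    by rewrite le_eqVlt; apply/orP; left; apply/eqP; ring.
  - apply: continuous_subspaceT => s.
    apply: differentiable_continuous; apply/derivable1_diffP.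
    exact: ex_derive.
rewrite /psi scale1r scale0r addr0 /v (addrC x (y - x)) subrK; lra.
Qed.

(* With step 1/(2L) the quadratic term of the descent lemma is absorbed by the
   polarization identity, whatever the direction [u] is. *)
Lemma descent_step (L : R) x u : 0 < L -> L_smooth L F ->
  enorm (grad F x) ^+ 2 <=
    4 * L * (F x - F (x - (1 / (2 * L)) *: u)) + enorm (u - grad F x) ^+ 2.
Proof.
move=> L0 /(@smooth_upper_bound L x (x - (1 / (2 * L)) *: u)).
rewrite [x - _ - x]addrAC subrr sub0r -scaleNr dotZr enormZ normrN
  (@ger0_norm _ (1 / (2 * L))); last first.
  by rewrite divr_ge0// mulr_ge0// ltW.
move=> H.
have -> : enorm (u - grad F x) ^+ 2 =
    enorm u ^+ 2 - 2 * dot (grad F x) u + enorm (grad F x) ^+ 2.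
  rewrite !enorm_dot !(dotDl, dotDr, dotNl, dotNr) (dotC u (grad F x)); ring.
rewrite scaleNr in H *.
have {}H := ler_wpM2l (ltW (mulr_gt0 (ltr0n R 4) L0)) H.
move: H; set A := F _; set B := F _; set D := dot _ _; set U := enorm u.
have -> : 4 * L * (B + - (1 / (2 * L)) * D + L / 2 * (1 / (2 * L) * U) ^+ 2)
  = 4 * L * B - 2 * D + U ^+ 2 / 2.
  by field; rewrite gt_eqF.
have : 0 <= U ^+ 2 by rewrite sqr_ge0.
lra.
Qed.

End descent.

(** * Borel measurability and independence of the past *)

Section borel_rV.
Context {R : realType} {n : nat}.

Lemma measurable_coord (i : 'I_n) :
  measurable_fun [set: borel_rV R n] (fun y : borel_rV R n => (y : 'rV[R]_n) 0 i).
Proof.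
apply: (measurability _ (RGenOpens.measurableE R)).
move=> _ [_ [a [b ->] <-]]; rewrite setTI; apply: sub_sigma_algebra.
have /continuousP := @coord_continuous R 1 n 0 i.
by apply; exact: interval_open.
Qed.

(** Boxes with rational corners form a countable base of the topology, which reduces Borel
    measurability of a map into R^n to that of its coordinates. *)
Definition ratbox (q : 'rV[rat]_n * 'rV[rat]_n) : set 'rV[R]_n :=
  [set y | forall i, ratr (q.1 0 i) < y 0 i < ratr (q.2 0 i)].

Lemma open_ratbox (U : set 'rV[R]_n) : open U ->
  U = \bigcup_q (if pselect (ratbox q `<=` U) then ratbox q else set0).
Proof.
move=> oU; apply/seteqP; split => [y Uy|y [q _]]; last first.
  by case: pselect => // qU /qU.
have : nbhs y U by apply: open_nbhs_nbhs; split.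
(* Balls are taken in the sup norm, so rational bounds within [e] of each coordinate give a box
   inside the ball. *)
move=> /nbhs_ballP[e /= e0 yU].
have /choice[a ya] : forall i : 'I_n, exists q : rat,
    y 0 i - e < ratr q < y 0 i.
  move=> i; have /rat_in_itvoo[q] : y 0 i - e < y 0 i by rewrite ltrBlDr ltrDl.
  by rewrite in_itv/= => yq; exists q.
have /choice[b yb] : forall i : 'I_n, exists q : rat,
    y 0 i < ratr q < y 0 i + e.
  move=> i; have /rat_in_itvoo[q] : y 0 i < y 0 i + e by rewrite ltrDl.
  by rewrite in_itv/= => yq; exists q.
exists (\row_i a i, \row_i b i) => //; case: pselect => [_ i|[]].
  by rewrite !mxE; case/andP: (ya i) => _ ->; case/andP: (yb i).
move=> z zab; apply: yU; split=> // i j; rewrite ord1 /ball /= ltr_norml.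
have := zab j; rewrite !mxE; have := ya j; have := yb j; lra.
Qed.

Lemma measurable_fun_rV d (T : measurableType d) (f : T -> borel_rV R n) :
  (forall i, measurable_fun setT (fun w => (f w : 'rV[R]_n) 0 i)) ->
  measurable_fun setT f.
Proof.
move=> mf; apply: (@measurability _ _ T (borel_rV R n) setT f
  (@open 'rV[R]_n)) => // _ [U oU <-].
rewrite setTI (open_ratbox oU) preimage_bigcup.
apply: countable_bigcupT_measurable; first exact: countableP.
move=> q; case: (pselect (ratbox q `<=` U)) => ?; last by rewrite preimage_set0.
have -> : f @^-1` ratbox q = \bigcap_(i in [set: 'I_n])
    ((fun w => (f w : 'rV[R]_n) 0 i) @^-1` `]ratr (q.1 0 i), ratr (q.2 0 i)[).
  apply/seteqP; split => w /= h i; last by have := h i I; rewrite /= in_itv.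
  by move=> _; rewrite /= in_itv; exact: h.
apply: fin_bigcap_measurable => // i _.
by rewrite -[_ @^-1` _]setTI; apply: mf => //; exact: measurable_itv.
Qed.

Lemma measurable_enorm d (T : measurableType d) (f : T -> 'rV[R]_n) :
  (forall i, measurable_fun setT (fun w => f w 0 i)) ->
  measurable_fun setT (fun w => enorm (f w)).
Proof.
move=> mf; rewrite /enorm.
apply: (@measurableT_comp _ _ _ _ _ _ (@Num.sqrt R)).
  by apply: continuous_measurable_fun; exact: sqrt_continuous.
by apply: measurable_sum => i; apply: measurable_funX.
Qed.

End borel_rV.

Section independence.
Context {R : realType} {dO dX : measure_display} {Omega : measurableType dO}
  {Xi : measurableType dX} {P : probability Omega R}.

(** The product rule on rectangles identifies the law of (Y, X) with the product of the law of Y and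
    D, by uniqueness of product measures; Tonelli's theorem then integrates out X first. [T] is
    arbitrary so that Y can be the identity into a coarser sigma-algebra. *)
Lemma integral_freeze {dT} {T : measurableType dT} (D : probability Xi R)
    (X : Omega -> Xi) (Y : Omega -> T) (h : T * Xi -> \bar R) :
  measurable_fun setT X -> measurable_fun setT Y ->
  (forall A B, measurable A -> measurable B ->
     P (Y @^-1` B `&` X @^-1` A) = P (Y @^-1` B) * D A)%E ->
  measurable_fun setT h -> (forall z, 0 <= h z)%E ->
  (\int[P]_w h (Y w, X w) = \int[P]_w \int[D]_z h (Y w, z))%E.
Proof.
move=> mX mY XY mh h0.
pose Y' : {mfun Omega >-> T} := HB.pack Y (isMeasurableFun.Build _ _ _ _ Y mY).
have mYX : measurable_fun setT (fun w => (Y w, X w)).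
  exact: measurable_fun_pair.
pose YX : {mfun Omega >-> (T * Xi)%type} :=
  HB.pack (fun w => (Y w, X w)) (isMeasurableFun.Build _ _ _ _ _ mYX).
have E : forall C, measurable C ->
    (distribution P Y' \x D)%E C = distribution P YX C.
  move=> C mC; apply: product_measure_unique mC => A B mA mB.
  by rewrite /distribution /pushforward /= -XY.
transitivity (\int[distribution P YX]_z h z)%E.
  by rewrite ge0_integral_distribution.
transitivity (\int[distribution P Y' \x D]_z h z)%E.
  by apply: eq_measure_integral => C mC _; exact: esym (E C mC).
rewrite fubini_tonelli1// ge0_integral_distribution//.
  exact: measurable_fun_fubini_tonelli_F.
by move=> y; apply: integral_ge0.
Qed.

Definition cylinder (I : choiceType) (S : set I) (X : I -> Omega -> Xi) :
    set (set Omega) :=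
  [set B | exists (J : {fset I}) (A : I -> set Xi),
    [/\ [set` J] `<=` S, (forall i, measurable (A i)) &
        B = \bigcap_(i in [set` J]) (X i @^-1` A i)]].

Context {I : choiceType}.
Implicit Types (S : set I) (X : I -> {RV P >-> Xi}).

Lemma cylinder_setT S (X : I -> Omega -> Xi) : cylinder S X setT.
Proof.
exists fset0, (fun=> setT); split => //.
by apply/seteqP; split => // w _ i; rewrite /= inE.
Qed.

Lemma cylinder_preimage S (X : I -> Omega -> Xi) i A : S i -> measurable A ->
  cylinder S X (X i @^-1` A).
Proof.
move=> Si mA; exists [fset i]%fset, (fun=> A); split => //.
  by move=> j; rewrite /= inE => /eqP ->.
apply/seteqP; split => w /=.
  by move=> wA j; rewrite /= inE => /eqP ->.
by apply; rewrite /= inE.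
Qed.

Lemma cylinder_setI S (X : I -> Omega -> Xi) : setI_closed (cylinder S X).
Proof.
move=> _ _ [J [A [JS mA ->]]] [K [B [KS mB ->]]].
(* An index that lies in only one of [J] and [K] gets [setT] as its other condition. *)
exists (J `|` K)%fset, (fun i => (if i \in J then A i else setT) `&`
   (if i \in K then B i else setT)); split.
- by move=> i; rewrite /= inE => /orP[/JS|/KS].
- by move=> i; apply: measurableI; case: ifP.
- apply/seteqP; split => w /=.
    move=> [wA wB] i; rewrite /= inE => iJK; split.
      by case: ifP => // /wA.
    by case: ifP => // /wB.
  move=> wAB; split => i /= ij.
    by have := wAB i; rewrite /= inE ij => -[].
  by have := wAB i; rewrite /= inE ij orbT => -[] // _.
Qed.

Lemma cylinder_measurable S X : cylinder S X `<=` measurable.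
Proof.
move=> _ [J [A [_ mA ->]]]; apply: fin_bigcap_measurable => // i _.
by rewrite -[_ @^-1` _]setTI; exact: measurable_funPT.
Qed.

(* The cylinders form a pi-system, so the product rule extends to the
   sigma-algebra that they generate. *)
Lemma independent_past S S' X i E A : mutually_independent S X ->
  S' `<=` S -> S i -> ~ S' i -> <<s cylinder S' X >> E -> measurable A ->
  (P (E `&` X i @^-1` A) = P E * P (X i @^-1` A))%E.
Proof.
move=> indX S'S Si S'i sE mA.
have mXA : measurable (X i @^-1` A).
  by rewrite -[_ @^-1` _]setTI; exact: measurable_funPT.
have Pfin : P (X i @^-1` A) \is a fin_num by exact: fin_num_measure.
have r0 : 0 <= fine (P (X i @^-1` A)) by exact: fine_ge0.
rewrite muleC -(fineK Pfin).
have gT : \bigcup_(k : nat) [set: Omega] = setT by rewrite bigcup_const.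
(* As functions of E both sides are finite measures: P restricted to the event that X_i lies in A,
   and P scaled by the probability of that event. It is enough to compare them on cylinders. *)
have := @g_sigma_algebra_measure_unique _ R _ (cylinder S' X)
  (@cylinder_measurable S' X) (fun=> setT) (fun=> @cylinder_setT S' X)
  gT (mrestr P mXA) (mscale (NngNum r0) P)
  (@cylinder_setI S' X).
apply => //; last first.
  by move=> _; rewrite /= /mrestr setTI -ge0_fin_numE.
move=> _ [J [B [JS mB ->]]]; rewrite /= /mrestr /mscale /= fineK//.
have iJ : i \notin J by apply/negP => /JS.
(* Independence is applied to [J] enlarged by [i], with A attached to the new index. *)
have := indX (i |` J)%fset (fun j => if j == i then A else B j).
rewrite big_fsetU1//= eqxx.
have -> : \bigcap_(j in [set` (i |` J)%fset])
    (X j @^-1` (if j == i then A else B j)) =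
    \bigcap_(j in [set` J]) (X j @^-1` B j) `&` X i @^-1` A.
  apply/seteqP; split => w /=.
    move=> h; split; last by have := h i; rewrite /= !inE eqxx; exact.
    move=> j /= jJ; have := h j; rewrite /= !inE jJ orbT.
    by case: eqP jJ => [-> /JS //|_ _]; exact.
  move=> [wB wA] j; rewrite /= !inE => /orP[/eqP ->|jJ]; first by rewrite eqxx.
  by case: eqP => [->//|_]; exact: wB.
move=> ->; last 2 first.
- by move=> j; rewrite /= !inE => /orP[/eqP ->//|/JS /S'S].
- by move=> j; case: ifP.
congr (_ * _)%E; rewrite (indX J B) //; last by move=> j /JS /S'S.
apply: eq_big_seq => j jJ; case: eqP jJ iJ => // -> ->; by [].
Qed.

End independence.

(** * Moments of a clipped random vector *)

(** Projection onto the ball of radius [lam]. Dividing by the maximum avoids the case v = 0 of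
    [clip_factor]. *)
Definition clip (R : realType) (d : nat) (lam : R) (v : 'rV[R]_d) : 'rV[R]_d :=
  (lam / Num.max lam (enorm v)) *: v.

Section clip.
Context {R : realType} {d : nat}.
Implicit Types (v : 'rV[R]_d) (lam p : R).

Lemma clip_factorE (alpha beta : R) k v : 0 < alpha * k%:R `^ beta^-1 ->
  clip_factor alpha beta k v *: v = clip (alpha * k%:R `^ beta^-1) v.
Proof.
rewrite /clip_factor /clip; set lam := alpha * _ => lam0.
case: (eqVneq v 0) => [->|v0]; first by rewrite !scaler0.
have a0 : 0 < enorm v by rewrite lt_def enorm_eq0 v0 enorm_ge0.
case: (leP lam (enorm v)) => h.
  by rewrite min_r// ler_pdivrMr// mul1r.
by rewrite min_l ?ler_pdivlMr ?mul1r ?(ltW h)// divff// gt_eqF.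
Qed.

Lemma enorm_clip lam v : 0 < lam -> enorm (clip lam v) = Num.min lam (enorm v).
Proof.
move=> lam0; rewrite /clip enormZ ger0_norm; last first.
  by apply: divr_ge0; rewrite ?le_max ltW.
case: (leP lam (enorm v)) => h; last by rewrite divff ?mul1r ?gt_eqF.
by rewrite divfK// gt_eqF// (lt_le_trans lam0).
Qed.

Lemma enorm_clip_le lam v : 0 < lam -> enorm (clip lam v) <= lam.
Proof. by move=> lam0; rewrite enorm_clip// ge_min lexx. Qed.

(** With a = min(lam, |v|) the square is a^(2-p) a^p. Both exponents are nonnegative, so a <= lam
    bounds the first factor and a <= |v| the second. *)
Lemma enorm_clip_sqr lam p v : 0 < lam -> 1 < p <= 2 ->
  enorm (clip lam v) ^+ 2 <= lam `^ (2 - p) * enorm v `^ p.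
Proof.
move=> lam0 /andP[p1 p2]; rewrite enorm_clip//.
have sqrE (a : R) : 0 <= a -> a ^+ 2 = a `^ (2 - p) * a `^ p.
  by move=> a0; rewrite -powRD subrK ?powR_mulrn// pnatr_eq0.
case: (leP lam (enorm v)) => h.
  rewrite sqrE ?(ltW lam0)// ler_wpM2l ?powR_ge0// ge0_ler_powR ?nnegrE//.
  - by rewrite ltW// (lt_trans ltr01).
  - exact: ltW.
  - exact: enorm_ge0.
rewrite sqrE ?enorm_ge0// ler_wpM2r ?powR_ge0// ge0_ler_powR ?nnegrE ?subr_ge0//.
- exact: enorm_ge0.
- exact: ltW.
- exact: ltW.
Qed.

(** The difference vanishes when |v| < lam. Otherwise it is at most |v|, and 1 <= (|v| /
    lam)^(p-1). *)
Lemma enorm_clipB lam p v : 0 < lam -> 1 < p ->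
  enorm (clip lam v - v) <= lam `^ (1 - p) * enorm v `^ p.
Proof.
move=> lam0 p1; rewrite -[X in _ - X]scale1r /clip -scalerBl enormZ.
case: (leP lam (enorm v)) => h; last first.
  by rewrite divff ?gt_eqF// subrr normr0 mul0r mulr_ge0 ?powR_ge0.
have v0 : 0 < enorm v by rewrite (lt_le_trans lam0).
apply: (@le_trans _ _ (1 * enorm v)).
  rewrite ler_wpM2r ?enorm_ge0// ler_norml.
  have q0 : 0 <= lam / enorm v by apply: divr_ge0; rewrite ltW.
  have q1 : lam / enorm v <= 1 by rewrite ler_pdivrMr ?mul1r.
  by apply/andP; split; lra.
rewrite -(mulr_powRB1 (enorm_ge0 v) (lt_trans ltr01 p1)) mulrCA [1 * _]mulrC.
rewrite ler_wpM2l ?enorm_ge0// -(opprB p 1) powRN mulrC.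
rewrite ler_pdivlMr ?powR_gt0// mul1r.
by apply: ge0_ler_powR; rewrite ?nnegrE ?enorm_ge0 ?subr_ge0 // ltW.
Qed.

Lemma measurable_clip dT (T : measurableType dT) lam (V : T -> 'rV[R]_d) i :
  0 < lam -> (forall j, measurable_fun setT (fun w => V w 0 j)) ->
  measurable_fun setT (fun w => clip lam (V w) 0 i).
Proof.
move=> lam0 mV.
have -> : (fun w => clip lam (V w) 0 i) =
    (fun w => lam * (Num.max lam (enorm (V w))) `^ (-1) * V w 0 i).
  by apply/funext => w; rewrite mxE powR_inv1// le_max ltW.
apply: measurable_funM => //; apply: measurable_funM => //.
apply: (measurableT_comp (measurable_powR _)).
by apply: measurable_maxr => //; exact: measurable_enorm.
Qed.

End clip.

Section clipped_moments.
Context {R : realType} {d : nat} {dX : measure_display} {Xi : measurableType dX}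
  (D : probability Xi R) (V : Xi -> 'rV[R]_d) (p S : R).
Hypothesis mV : forall i, measurable_fun setT (fun z => V z 0 i).
Hypothesis p12 : 1 < p <= 2.
Hypothesis VS : (\int[D]_z (enorm (V z) `^ p)%:E <= S%:E)%E.

(** [fine] sends an infinite integral to 0, so this is the mean only when the coordinates are
    integrable. *)
Definition vmean (U : Xi -> 'rV[R]_d) : 'rV[R]_d :=
  \row_i fine (\int[D]_z (U z 0 i)%:E)%E.

Lemma integrable_moment : D.-integrable setT (EFin \o (fun z => enorm (V z) `^ p)).
Proof.
apply/integrableP; split.
  apply/measurable_EFinP; apply: (measurableT_comp (measurable_powR _)).
  exact: measurable_enorm.
under eq_integral do rewrite gee0_abs ?lee_fin ?powR_ge0//.
by rewrite (le_lt_trans VS)// ltry.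
Qed.

(** Each coordinate is dominated by |V| <= 1 + |V|^p, as p > 1. *)
Lemma integrable_oracle i : D.-integrable setT (EFin \o (fun z => V z 0 i)).
Proof.
have : D.-integrable setT ((EFin \o cst 1%R) \+ (EFin \o (fun z => (enorm (V z) `^ p)%R)))%E.
  apply: integrableD => //; last exact: integrable_moment.
  exact: finite_measure_integrable_cst.
apply: le_integrable => //; first exact/measurable_EFinP.
move=> z _; rewrite /= lee_fin (le_trans (le_coord_enorm _ _))//.
rewrite ger0_norm ?addr_ge0 ?powR_ge0//.
have [v1|v1] := leP (enorm (V z)) 1.
  by rewrite (le_trans v1)// lerDl powR_ge0.
rewrite -[leLHS]powRr1 ?enorm_ge0// (@le_trans _ _ (enorm (V z) `^ p))//.
  by case/andP: p12 => p1 _; rewrite ler_powR// ltW.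
by rewrite lerDr.
Qed.

Lemma integral_dot (U : Xi -> 'rV[R]_d) (u : 'rV[R]_d) :
  (forall i, D.-integrable setT (EFin \o (fun z => U z 0 i))) ->
  (\int[D]_z (dot u (U z))%:E = (dot u (vmean U))%:E)%E.
Proof.
move=> iU; under eq_integral do rewrite /dot -sumEFin.
rewrite integral_sum//; last first.
  move=> i; rewrite (_ : (fun _ => _) = fun z => (u 0 i)%:E * (U z 0 i)%:E)%E.
    by apply: integrableZl => //; exact: iU.
  by apply/funext => z; rewrite EFinM.
rewrite /dot -sumEFin; apply: eq_bigr => i _.
under eq_integral do rewrite EFinM.
rewrite integralZl//; last exact: iU.
by rewrite mxE EFinM fineK//; apply: integrable_fin_num => //; exact: iU.
Qed.

Lemma integrable_dot (U : Xi -> 'rV[R]_d) (u : 'rV[R]_d) :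
  (forall i, D.-integrable setT (EFin \o (fun z => U z 0 i))) ->
  D.-integrable setT (EFin \o (fun z => dot u (U z))).
Proof.
move=> iU.
rewrite (_ : _ \o _ = fun z => \sum_(i < d) (u 0 i)%:E * (U z 0 i)%:E)%E.
  apply: integrable_sum => // i _; apply: integrableZl => //; exact: iU.
by apply/funext => z; rewrite /= /dot -sumEFin.
Qed.

Variable lam : R.
Hypothesis lam0 : 0 < lam.

Lemma integrable_clip i :
  D.-integrable setT (EFin \o (fun z => clip lam (V z) 0 i)).
Proof.
apply: measurable_bounded_integrable => //.
- by rewrite -ge0_fin_numE// fin_num_measure.
- exact: measurable_clip.
- exists lam; split; first exact: num_real.
  move=> M lamM z _ /=; rewrite (le_trans (le_coord_enorm _ _))//.
  by rewrite (le_trans (enorm_clip_le _ _))// ltW.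
Qed.

(* Jensen's inequality, by pairing with the bias itself. *)
Lemma clip_bias :
  enorm (vmean (fun z => clip lam (V z)) - vmean V) <= lam `^ (1 - p) * S.
Proof.
set b := _ - _.
have [b0|b0] := eqVneq (enorm b) 0.
  rewrite b0 mulr_ge0 ?powR_ge0// -lee_fin (le_trans _ VS)//.
  by apply: integral_ge0 => z _; rewrite lee_fin powR_ge0.
have bgt0 : 0 < enorm b by rewrite lt_def b0 enorm_ge0.
(* After multiplication by |b| > 0 the left side is <b, b>, which equals the mean of <b, clip V - V>
   by linearity. *)
rewrite -(ler_pM2l bgt0) -expr2 enorm_dot -lee_fin.
have -> : ((dot b b)%:E = \int[D]_z (dot b (clip lam (V z) - V z))%:E)%E.
  under eq_integral do rewrite dotDr dotNr EFinB.
  rewrite integralB_EFin//; [|exact/integrable_dot/integrable_clip|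
    exact/integrable_dot/integrable_oracle].
  rewrite !integral_dot; [|exact: integrable_oracle|exact: integrable_clip].
  by rewrite -EFinB -dotNr -dotDr.
pose c := enorm b * lam `^ (1 - p).
have c0 : 0 <= c by rewrite mulr_ge0 ?powR_ge0 ?enorm_ge0.
apply: (@le_trans _ _ (\int[D]_z (c%:E * (enorm (V z) `^ p)%:E))%E); last first.
  rewrite integralZl//; last exact: integrable_moment.
  by rewrite mulrA -/c [leRHS]EFinM; apply: lee_wpmul2l; rewrite ?lee_fin.
apply: le_integral => //.
- rewrite (_ : (fun _ => _) =
    (EFin \o (fun z => dot b (clip lam (V z)))) \-
    (EFin \o (fun z => dot b (V z))))%E.
    by apply: integrableB => //; apply: integrable_dot;
      [exact: integrable_clip|exact: integrable_oracle].
  by apply/funext => z /=; rewrite dotDr dotNr.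
- by apply: integrableZl => //; exact: integrable_moment.
- move=> z _; rewrite -EFinM lee_fin (le_trans (cauchy_schwarz _ _))// -mulrA.
  by rewrite ler_wpM2l ?enorm_ge0// enorm_clipB//; case/andP: p12.
Qed.

Lemma integrable_clip_sqr :
  D.-integrable setT (EFin \o (fun z => enorm (clip lam (V z)) ^+ 2)).
Proof.
apply: measurable_bounded_integrable => //.
- by rewrite -ge0_fin_numE// fin_num_measure.
- apply: measurable_funX; apply: measurable_enorm => i; exact: measurable_clip.
- exists (lam ^+ 2); split; first exact: num_real.
  move=> M lamM z _ /=; rewrite ger0_norm ?sqr_ge0// (le_trans _ (ltW lamM))//.
  by rewrite ler_sqr ?nnegrE ?enorm_ge0 ?(ltW lam0)// enorm_clip_le.
Qed.

Lemma clip_second_moment :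
  (\int[D]_z (enorm (clip lam (V z)) ^+ 2)%:E <= (lam `^ (2 - p) * S)%:E)%E.
Proof.
apply: (@le_trans _ _
    (\int[D]_z ((lam `^ (2 - p))%:E * (enorm (V z) `^ p)%:E))%E); last first.
  rewrite integralZl//; last exact: integrable_moment.
  by rewrite EFinM; apply: lee_wpmul2l; rewrite ?lee_fin ?powR_ge0.
apply: le_integral => //; first exact: integrable_clip_sqr.
  by apply: integrableZl => //; exact: integrable_moment.
by move=> z _; rewrite -EFinM lee_fin enorm_clip_sqr.
Qed.

(** The added noise is centred, so its cross term with the fixed vector [v] has mean zero, and a
    variance is at most the second moment. *)
Lemma clip_noise (v : 'rV[R]_d) (r : R) :
  (\int[D]_z (enorm (v + r *: (clip lam (V z) - vmean (fun z => clip lam (V z)))) ^+ 2)%:E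
   <= (enorm v ^+ 2 + r ^+ 2 * (lam `^ (2 - p) * S))%:E)%E.
Proof.
(* Collecting the constants in w = v - r m leaves only a linear and a quadratic term in the clipped
   vector to integrate. *)
set m := vmean _; have [w wE] : exists w, w = v - r *: m by exists (v - r *: m).
have E z : enorm (v + r *: (clip lam (V z) - m)) ^+ 2 =
    enorm w ^+ 2 + (dot ((2 * r) *: w) (clip lam (V z))
    + r ^+ 2 * enorm (clip lam (V z)) ^+ 2).
  have -> : v + r *: (clip lam (V z) - m) = w + r *: clip lam (V z).
    by rewrite scalerBr wE addrAC addrA.
  move: (clip _ _) => u.
  rewrite !enorm_dot !(dotDl, dotDr, dotZl, dotZr) (dotC _ w); ring.
under eq_integral do rewrite E EFinD.
have icst (c : R) : D.-integrable setT (EFin \o cst c).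
  exact: finite_measure_integrable_cst.
have isq : D.-integrable setT
    (EFin \o (fun z => r ^+ 2 * enorm (clip lam (V z)) ^+ 2)).
  rewrite (_ : _ \o _ = (fun z =>
    (r ^+ 2)%:E * (EFin \o (fun z => (enorm (clip lam (V z)) ^+ 2)%R)) z))%E.
    by apply: integrableZl => //; exact: integrable_clip_sqr.
  by apply/funext => z; rewrite /= EFinM.
have idot := integrable_dot ((2 * r) *: w) integrable_clip.
rewrite (@integralD_EFin _ _ _ _ _ _ (cst (enorm w ^+ 2)) (fun z =>
   dot ((2 * r) *: w) (clip lam (V z)) + r ^+ 2 * enorm (clip lam (V z)) ^+ 2))//;
  last first.
  rewrite (_ : _ \o _ = (EFin \o (fun z => dot ((2 * r) *: w) (clip lam (V z))))
   \+ (EFin \o (fun z => (r ^+ 2 * enorm (clip lam (V z)) ^+ 2)%R)))%E//.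
  exact: integrableD.
under [X in (_ + X)%E]eq_integral do rewrite /= EFinD.
rewrite (@integralD_EFin _ _ _ _ _ _
  (fun z => dot ((2 * r) *: w) (clip lam (V z)))
  (fun z => r ^+ 2 * enorm (clip lam (V z)) ^+ 2))//.
rewrite integral_dot; last exact: integrable_clip.
under [X in (_ + (_ + X))%E]eq_integral do rewrite /= EFinM.
rewrite integralZl//; last exact: integrable_clip_sqr.
have -> : (\int[D]_z (EFin \o cst (enorm w ^+ 2)%R) z = (enorm w ^+ 2)%:E)%E.
  by rewrite -[RHS]mule1 -(probability_setT D) -integral_cst.
have := clip_second_moment.
set Q := (\int[D]_x _)%E => QS.
apply: (@le_trans _ _ ((enorm w ^+ 2)%:E + ((dot ((2 * r) *: w) m)%:E +
    (r ^+ 2)%:E * (lam `^ (2 - p) * S)%:E))%E).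
  rewrite !leeD2l//; apply: lee_wpmul2l => //; rewrite lee_fin; exact: sqr_ge0.
rewrite -EFinM -!EFinD lee_fin addrA lerD2r -subr_ge0.
(* The slack r^2 |m|^2 is the gap between second moment and variance. *)
have -> : enorm v ^+ 2 - (enorm w ^+ 2 + dot ((2 * r) *: w) m) = r ^+ 2 * enorm m ^+ 2.
  have -> : v = w + r *: m by rewrite wE subrK.
  move: m {E wE} => m.
  rewrite !enorm_dot !(dotDl, dotDr, dotZl, dotZr) (dotC m w); ring.
by rewrite mulr_ge0 ?sqr_ge0.
Qed.

End clipped_moments.

(** * Power sums and the batch size *)

Section power_sums.
Context {R : realType}.
Implicit Types (p sigma : R) (n k : nat).

(* Bernoulli's inequality [(1 - 1/k)^(1/p) <= 1 - 1/(pk)], obtained from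
   Young's inequality, gives the telescoping bound on each summand. *)
Lemma powR_telescope p k : 1 < p ->
  k.+1%:R `^ (p^-1 - 1) <= p * (k.+1%:R `^ p^-1 - k%:R `^ p^-1).
Proof.
move=> p1.
have p0 : 0 < p by rewrite (lt_trans ltr01).
have K0 : 0 < k.+1%:R :> R by rewrite ltr0n.
set K := k.+1%:R; set u := k%:R / K.
have u0 : 0 <= u by rewrite /u divr_ge0// ler0n.
have q0 : 0 < (1 - p^-1)^-1 by rewrite invr_gt0 subr_gt0 invf_lt1.
(* Young's inequality for u^(1/p) and 1 reads u^(1/p) <= u/p + 1 - 1/p, where u = k/(k+1) = 1 -
   1/(k+1). *)
have := @conjugate_powR R (u `^ p^-1) 1 p (1 - p^-1)^-1 (powR_ge0 _ _) ler01 p0 q0.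
rewrite invrK addrC subrK => /(_ erefl).
rewrite mulr1 -powRrM mulVf ?gt_eqF// powRr1// powR1 mul1r => H.
have -> : k%:R = u * K by rewrite /u divfK// gt_eqF.
rewrite powRM ?(ltW K0)// powRB ?(gt_eqF K0) ?implybT// powRr1 ?(ltW K0)//.
have uE : u = 1 - K^-1.
  by rewrite /u /K -natr1 -[X in X / _](addrK 1) mulrBl divff ?mul1r ?gt_eqF ?ltr_pwDr.
rewrite -[X in X - _]mul1r -mulrBl mulrA mulrC ler_wpM2r ?powR_ge0//.
have : p * u `^ p^-1 <= p * (u / p + (1 - p^-1)) by rewrite ler_wpM2l// ltW.
rewrite uE.
have -> : p * ((1 - K^-1) / p + (1 - p^-1)) = p - K^-1 by field; rewrite !gt_eqF.
by rewrite mulrBr mulr1 lerBrDl lerBrDr.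
Qed.

Lemma sum_powR_le p n : 1 < p ->
  \sum_(1 <= k < n.+1) k%:R `^ (p^-1 - 1) <= p * n%:R `^ p^-1.
Proof.
move=> p1; have p0 : 0 < p by rewrite (lt_trans ltr01).
elim: n => [|n IH].
  by rewrite big_geq// powR0 ?mulr0// invr_eq0 gt_eqF.
rewrite big_nat_recr//=; have := powR_telescope n p1; lra.
Qed.

(** At level sigma k^(1/p) each summand collapses to sigma k^(1/p - 1), and these powers sum to at
    most p n^(1/p). *)
Lemma mean_bias_le p sigma n : 1 < p -> 0 < sigma -> (0 < n)%N ->
  n%:R^-1 * \sum_(1 <= k < n.+1)
    (sigma * k%:R `^ p^-1) `^ (1 - p) * sigma `^ p
  <= p * sigma * n%:R `^ (p^-1 - 1).
Proof.
move=> p1 s0 n0; have p0 : 0 < p by rewrite (lt_trans ltr01).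
have n0' : 0 < n%:R :> R by rewrite ltr0n.
rewrite [X in _ * X](_ : _ = sigma * \sum_(1 <= k < n.+1) k%:R `^ (p^-1 - 1)).
  rewrite powRB ?(gt_eqF n0') ?implybT// powRr1 ?ler0n// mulrA.
  rewrite mulrC ler_pdivlMr// mulrAC mulfK ?gt_eqF//.
  rewrite -(mulrA p) mulrCA ler_wpM2l ?(ltW s0)//.
  exact: sum_powR_le.
rewrite mulr_sumr; apply: eq_big_nat => k /andP[k1 _].
rewrite powRM ?(ltW s0) ?powR_ge0// -powRrM mulrBr mulr1 mulVf ?gt_eqF//.
by rewrite mulrAC -powRD ?subrK ?powRr1 ?(ltW s0)// (gt_eqF s0) implybT.
Qed.

(** Each summand is sigma^2 k^(2/p - 1) / n^2. Since p <= 2 the exponent is nonnegative, so k can be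
    replaced by n; n equal terms then give sigma^2 n^(2/p - 2). *)
Lemma mean_variance_le p sigma n : 1 < p <= 2 -> 0 < sigma -> (0 < n)%N ->
  \sum_(1 <= k < n.+1)
    n%:R^-1 ^+ 2 * ((sigma * k%:R `^ p^-1) `^ (2 - p) * sigma `^ p)
  <= sigma ^+ 2 * (n%:R `^ (p^-1 - 1)) ^+ 2.
Proof.
move=> /andP[p1 p2] s0 n0; have p0 : 0 < p by rewrite (lt_trans ltr01).
have n0' : 0 < n%:R :> R by rewrite ltr0n.
have e0 : 0 <= 2 * p^-1 - 1 by rewrite subr_ge0 ler_pdivlMr// mul1r.
apply: (@le_trans _ _ (\sum_(1 <= k < n.+1)
    n%:R^-1 ^+ 2 * (sigma ^+ 2 * n%:R `^ (2 * p^-1 - 1)))).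
  apply: ler_sum_nat => k /andP[k1 kn].
  rewrite ler_wpM2l ?sqr_ge0// powRM ?(ltW s0) ?powR_ge0// -powRrM.
  rewrite mulrBr mulVf ?gt_eqF// (mulrC _ 2) mulrAC -powRD; last first.
    by rewrite (gt_eqF s0) implybT.
  rewrite subrK powR_mulrn ?(ltW s0)// ler_wpM2l ?sqr_ge0//.
  by apply: ge0_ler_powR; rewrite ?nnegrE ?ler_nat.
rewrite sumr_const_nat subn1/= le_eqVlt; apply/orP; left; apply/eqP.
have -> : n%:R `^ (2 / p - 1) = n%:R `^ p^-1 ^+ 2 / n%:R.
  rewrite powRB ?(gt_eqF n0') ?implybT// powRr1 ?ler0n//.
  by rewrite (mulrC 2) powRrM powR_mulrn ?powR_ge0.
have -> : n%:R `^ (p^-1 - 1) = n%:R `^ p^-1 / n%:R.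
  by rewrite powRB ?(gt_eqF n0') ?implybT// powRr1 ?ler0n.
rewrite -mulr_natl.
by field; rewrite gt_eqF.
Qed.

Lemma batch_size_ge p L sigma Delta1 T :
  (sigma ^+ 2 * T%:R / (Delta1 * L)) `^ (p / (2 * (p - 1))) <=
  (batch_size p L sigma Delta1 T)%:R.
Proof.
rewrite /batch_size; set m := Num.max _ _.
have m1 : 1 <= m by rewrite le_max lexx.
(* The absolute value in [batch_size] only casts an integer to [nat]: the ceiling is nonnegative. *)
have c0 : 0 <= Num.ceil m by rewrite -(@ler_int R) (le_trans _ (ceil_ge _))// (le_trans ler01).
rewrite natr_absz ger0_norm//.
by rewrite (le_trans _ (ceil_ge _))// le_max lexx orbT.
Qed.

Lemma batch_size_gt0 p L sigma Delta1 T :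
  (0 < batch_size p L sigma Delta1 T)%N.
Proof.
rewrite /batch_size absz_gt0 gt_eqF// -(@ltr_int R).
by rewrite (lt_le_trans ltr01)// (le_trans _ (ceil_ge _))// le_max lexx.
Qed.

(** For the sample complexity: a ceiling exceeds its argument by less than 1, and max(1, A) <= 1 +
    A. *)
Lemma batch_size_le p L sigma Delta1 T :
  (batch_size p L sigma Delta1 T)%:R <=
  2 + (sigma ^+ 2 * T%:R / (Delta1 * L)) `^ (p / (2 * (p - 1))).
Proof.
rewrite /batch_size; set A := powR _ _; set m := Num.max _ _.
have A0 : 0 <= A by exact: powR_ge0.
have mA : m <= 1 + A by rewrite ge_max; apply/andP; split; lra.
have m1 : 1 <= m by rewrite le_max lexx.
have c0 : 0 <= Num.ceil m by rewrite -(@ler_int R) (le_trans _ (ceil_ge _))// (le_trans ler01).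
rewrite natr_absz ger0_norm//.
have := ceilB1_lt m; rewrite intrB mulr1z; lra.
Qed.

(** The exponents p/(2(p-1)) and 2(1 - 1/p) are reciprocal, so the lower bound on n becomes A <=
    n^(2 - 2/p). *)
Lemma batch_rate p L sigma Delta1 T n : 1 < p -> 0 < L -> 0 < sigma ->
  0 < Delta1 -> (0 < T)%N ->
  (sigma ^+ 2 * T%:R / (Delta1 * L)) `^ (p / (2 * (p - 1))) <= n%:R ->
  sigma ^+ 2 * (n%:R `^ (p^-1 - 1)) ^+ 2 <= Delta1 * L / T%:R.
Proof.
move=> p1 L0 s0 D0 T0; set A := _ / _ => An.
have p0 : 0 < p by rewrite (lt_trans ltr01).
have T0' : 0 < T%:R :> R by rewrite ltr0n.
have A0 : 0 < A by rewrite divr_gt0 ?mulr_gt0 ?exprn_gt0.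
have n0 : 0 < n%:R :> R by rewrite (lt_le_trans _ An)// powR_gt0.
have e0 : 0 <= 2 * (1 - p^-1) by rewrite mulr_ge0// subr_ge0 invf_le1// ltW.
have : A <= n%:R `^ (2 * (1 - p^-1)).
  have -> : A = (A `^ (p / (2 * (p - 1)))) `^ (2 * (1 - p^-1)).
    rewrite -powRrM (_ : p / (2 * (p - 1)) * (2 * (1 - p^-1)) = 1) ?powRr1 ?ltW//.
    by field; rewrite subr_eq0 !gt_eqF.
  by apply: ge0_ler_powR; rewrite ?nnegrE ?powR_ge0 ?ler0n.
have -> : 2 * (1 - p^-1) = (1 - p^-1) * 2%:R by rewrite mulrC.
rewrite powRrM powR_mulrn ?powR_ge0// -(opprB 1 p^-1) powRN exprVn.
rewrite /A ler_pdivrMr ?mulr_gt0// => H.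
rewrite ler_pdivrMr ?exprn_gt0 ?powR_gt0// mulrAC ler_pdivlMr//.
by rewrite [leRHS]mulrC.
Qed.

End power_sums.

(** * Per-sample clipped SGD *)

Section measurability.
Context {R : realType}.

Lemma measurable_sum_nat d (T : measurableType d) (m n : nat)
    (h : nat -> T -> R) :
  (forall k, (m <= k < n)%N -> measurable_fun setT (h k)) ->
  measurable_fun setT (fun w => \sum_(m <= k < n) h k w).
Proof.
move=> mh.
(* Terms outside the range become 0, because [mh] covers only indices inside it. *)
rewrite (_ : (fun _ => _) = fun w =>
    \sum_(k <- index_iota m n) if (m <= k < n)%N then h k w else 0).
  apply: measurable_sum => k; move: (mh k).
  case: (m <= k < n)%N => [/(_ isT)//|_]; exact: measurable_cst.
by apply/funext => w; apply: eq_big_nat => k mk; rewrite mk.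
Qed.

Lemma integral_cst_probability d (T : measurableType d) (P : probability T R)
    (c : R) : (\int[P]_w (cst c%:E w) = c%:E)%E.
Proof. by rewrite -[RHS]mule1 -(probability_setT P) -integral_cst. Qed.

(** The integrand may change sign, so Tonelli's measurability is applied to its positive and
    negative parts. *)
Lemma measurable_fine_integral d1 d2 (T : measurableType d1)
    (Xi : measurableType d2) (D : probability Xi R) (f : T * Xi -> R) :
  measurable_fun setT f ->
  measurable_fun setT (fun y => fine (\int[D]_z (f (y, z))%:E)%E).
Proof.
move=> mf.
have mF : measurable_fun setT (EFin \o f) by exact/measurable_EFinP.
apply: (measurableT_comp (fine_measurable measurableT)).
rewrite (_ : (fun _ => _) = (fun y => fubini_F D (EFin \o f)^\+ y -
    fubini_F D (EFin \o f)^\- y))%E.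
  apply: emeasurable_funB; apply: measurable_fun_fubini_tonelli_F => //.
  - exact: measurable_funepos.
  - exact: measurable_funeneg.
apply/funext => y; rewrite integralE /fubini_F; congr (_ - _)%E;
  by apply: eq_integral => z _; rewrite ?funeposE ?funenegE.
Qed.

End measurability.

Section sgd.
Context {R : realType} {d : nat} {dX dO : measure_display}
  {Xi : measurableType dX} {Omega : measurableType dO}.
Variables (p sigma : R) (F : 'rV[R]_d -> R) (D : probability Xi R)
  (g : 'rV[R]_d -> Xi -> 'rV[R]_d) (P : probability Omega R).
Variables (T n : nat) (eta : nat -> R) (x1 : 'rV[R]_d)
  (xi : nat -> nat -> {RV P >-> Xi}) (x : nat -> Omega -> 'rV[R]_d).
Hypothesis p12 : 1 < p <= 2.
Hypothesis s0 : 0 < sigma.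
Hypothesis n0 : (0 < n)%N.
Hypothesis oracle : stochastic_gradient_oracle F D p sigma g.
Hypothesis iid : iid_samples D T n xi.
Hypothesis sgd : ps_clip_sgd g sigma p n eta x1 T (fun t k => xi t k) x.

Let xi' (tk : nat * nat) : {RV P >-> Xi} := xi tk.1 tk.2.

Definition level (k : nat) : R := sigma * k%:R `^ p^-1.

Lemma level_gt0 k : (0 < k)%N -> 0 < level k.
Proof. by move=> k0; rewrite mulr_gt0// powR_gt0// ltr0n. Qed.

(** At y = x_t this is the conditional mean of the k-th clipped sample given the past. *)
Definition clipped_mean (k : nat) (y : 'rV[R]_d) : 'rV[R]_d :=
  vmean D (fun z => clip (level k) (g y z)).

Definition in_range (s : nat * nat) : Prop :=
  (1 <= s.1 <= T)%N && (1 <= s.2 <= n)%N.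

(** Samples are ordered lexicographically, as if drawn one by one within a batch; [past t 0] holds
    exactly those of the iterations before [t]. *)
Definition past (t k : nat) : set (nat * nat) :=
  [set s | in_range s /\ ((s.1 < t) || (s.1 == t) && (s.2 <= k))%N].

(** [Omega] with the sigma-algebra generated by the samples in [S]. The identity into this space
    serves as the random variable that records the past. *)
Definition history (S : set (nat * nat)) :=
  g_sigma_algebraType (cylinder S (fun s => xi s.1 s.2 : Omega -> Xi)).

Lemma measurable_history S dT (T' : measurableType dT) (f : Omega -> T') :
  measurable_fun (setT : set (history S)) (f : history S -> T') ->
  measurable_fun setT f.
Proof.
move=> mf _ A mA; have := mf measurableT A mA.
apply: smallest_sub; first exact: sigma_algebra_measurable.
exact: (@cylinder_measurable _ _ _ _ _ _ _ S xi').
Qed.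

Lemma measurable_sample S t k : S (t, k) ->
  measurable_fun (setT : set (history S)) (xi t k : history S -> Xi).
Proof.
move=> St _ A mA; rewrite setTI; apply: sub_sigma_algebra.
exact: (@cylinder_preimage _ _ _ _ _ S (fun s => xi s.1 s.2) (t, k)).
Qed.

Lemma measurable_oracle dT (T' : measurableType dT) (X : T' -> 'rV[R]_d)
    (Z : T' -> Xi) i :
  measurable_fun setT (X : T' -> borel_rV R d) -> measurable_fun setT Z ->
  measurable_fun setT (fun w => g (X w) (Z w) 0 i).
Proof.
move=> mX mZ; case: oracle => mg _ _.
have := measurableT_comp mg (measurable_fun_pair mX mZ).
exact: measurableT_comp (measurable_coord i).
Qed.

Lemma measurable_oracle_at y i : measurable_fun setT (fun z => g y z 0 i).
Proof. exact: measurable_oracle. Qed.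

Lemma measurable_vmean_oracle (f : 'rV[R]_d -> 'rV[R]_d) i :
  measurable_fun setT (fun z : borel_rV R d * Xi => f (g z.1 z.2) 0 i) ->
  measurable_fun setT
    (fun y : borel_rV R d => vmean D (fun z => f (g y z)) 0 i).
Proof.
move=> mf; rewrite (_ : (fun _ => _) = fun y : borel_rV R d =>
  fine (\int[D]_z (f (g y z) 0 i)%:E)%E).
  exact: (measurable_fine_integral D mf).
by apply/funext => y; rewrite mxE.
Qed.

Lemma measurable_clipped_mean k i : (0 < k)%N ->
  measurable_fun setT (fun y : borel_rV R d => clipped_mean k y 0 i).
Proof.
move=> k0; apply: (@measurable_vmean_oracle (clip (level k))).
by apply: measurable_clip; [exact: level_gt0|move=> j; exact: measurable_oracle].
Qed.

Lemma grad_vmean y : grad F y = vmean D (g y).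
Proof.
case: oracle => _ mean _; apply/rowP => i; rewrite [RHS]mxE.
by have := mean y i; rewrite unlock => ->.
Qed.

(** By unbiasedness the gradient is a parameter integral of the jointly measurable oracle. *)
Lemma measurable_grad i :
  measurable_fun setT (fun y : borel_rV R d => grad F y 0 i).
Proof.
rewrite (_ : (fun _ => _) = fun y : borel_rV R d => vmean D (g y) 0 i).
  by apply: (@measurable_vmean_oracle id); exact: measurable_oracle.
by apply/funext => y; rewrite grad_vmean.
Qed.

Lemma oracle_moment y :
  (\int[D]_z (enorm (g y z) `^ p)%:E <= (sigma `^ p)%:E)%E.
Proof. by case: oracle => _ _ /(_ y); rewrite unlock. Qed.

Lemma estimatorE y (z : nat -> Xi) :
  ps_clip_estimator g sigma p n y z =
  n%:R^-1 *: \sum_(1 <= k < n.+1) clip (level k) (g y (z k)).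
Proof.
congr (_ *: _); apply: eq_big_nat => k /andP[k1 _].
by rewrite clip_factorE//; exact: level_gt0.
Qed.

(** x_{t+1} is a measurable function of x_t and the samples of iteration t, and x_1 is constant. Any
    [S] containing the earlier samples is allowed, so the induction stays in one sigma-algebra. *)
Lemma measurable_iterate S t : (1 <= t <= T.+1)%N ->
  (forall s k, (1 <= s < t)%N -> (1 <= k <= n)%N -> S (s, k)) ->
  measurable_fun (setT : set (history S)) (x t : history S -> borel_rV R d).
Proof.
case: t => // t /andP[_]; elim: t => [|t IH] tT tS.
  case: sgd => x1E _; rewrite (_ : x 1%N = fun=> x1) ?measurable_cst//.
  exact/funext.
have mt : measurable_fun (setT : set (history S)) (x t.+1 : history S -> borel_rV R d).
  by apply: IH => [|s k /andP[s1 st]]; [exact: ltnW|apply: tS; rewrite s1 ltnW].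
case: sgd => _ step; apply: measurable_fun_rV => i.
rewrite (_ : (fun _ => _) = fun w => x t.+1 w 0 i - eta t.+1 * (n%:R^-1 *
    \sum_(1 <= k < n.+1) clip (level k) (g (x t.+1 w) (xi t.+1 k w)) 0 i)); last first.
  by apply/funext => w; rewrite step// estimatorE !mxE summxE.
apply: measurable_funB; first exact: measurableT_comp (measurable_coord i) mt.
do 2!apply: measurable_funM => //.
apply: measurable_sum_nat => k /andP[k1 kn].
apply: measurable_clip; first exact: level_gt0.
move=> j; apply: measurable_oracle => //; apply: measurable_sample.
by apply: tS; rewrite ?ltnSn ?k1.
Qed.

(** * Error of the estimator within one iteration *)

Section one_iteration.
Variable t : nat.
Hypothesis tT : (1 <= t <= T)%N.

Definition bias (y : 'rV[R]_d) : 'rV[R]_d :=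
  n%:R^-1 *: (\sum_(1 <= k < n.+1) clipped_mean k y) - grad F y.

(* Interpolates between the bias ([k = 0]) and the error of the estimator
   ([k = n]) by replacing the conditional means with samples one at a time. *)
Definition partial_error (k : nat) (w : Omega) : 'rV[R]_d :=
  bias (x t w) + n%:R^-1 *:
    \sum_(1 <= j < k.+1) (clip (level j) (g (x t w) (xi t j w)) - clipped_mean j (x t w)).

Lemma partial_error_last w : partial_error n w =
  ps_clip_estimator g sigma p n (x t w) (fun k => xi t k w) - grad F (x t w).
Proof.
rewrite estimatorE /partial_error /bias sumrB scalerBr.
by rewrite addrC addrA subrK.
Qed.

Lemma enorm_bias_le y : enorm (bias y) <= p * sigma * n%:R `^ (p^-1 - 1).
Proof.
have p1 : 1 < p by case/andP: p12.
rewrite (le_trans _ (mean_bias_le p1 s0 n0))//.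
have -> : bias y = n%:R^-1 *: \sum_(1 <= k < n.+1) (clipped_mean k y - grad F y).
  rewrite sumrB sumr_const_nat subn1/= scalerBr -[grad F y *+ n]scaler_nat.
  by rewrite scalerA mulVf ?scale1r// pnatr_eq0 -lt0n.
rewrite enormZ ger0_norm ?invr_ge0 ?ler0n// ler_wpM2l ?invr_ge0 ?ler0n//.
rewrite (le_trans (enorm_sum _ _ _))//.
apply: ler_sum_nat => k /andP[k1 _]; rewrite grad_vmean.
apply: clip_bias => //.
- by move=> i; exact: measurable_oracle_at.
- exact: oracle_moment.
- exact: level_gt0.
Qed.

Lemma partial_error_recr k w : partial_error k.+1 w = partial_error k w +
  n%:R^-1 *: (clip (level k.+1) (g (x t w) (xi t k.+1 w))
              - clipped_mean k.+1 (x t w)).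
Proof. by rewrite /partial_error big_nat_recr//= scalerDr addrA. Qed.

Lemma measurable_iterate_past k :
  measurable_fun (setT : set (history (past t k)))
    (x t : history (past t k) -> borel_rV R d).
Proof.
case/andP: tT => t1 tT'; apply: measurable_iterate; first by rewrite t1 leqW.
move=> s j /andP[s1 st] jn; split => /=; last by rewrite st.
by rewrite /in_range /= s1 jn (leq_trans (ltnW st)).
Qed.

Lemma measurable_bias i :
  measurable_fun setT (fun y : borel_rV R d => bias y 0 i).
Proof.
rewrite (_ : (fun _ => _) = fun y : borel_rV R d =>
    n%:R^-1 * (\sum_(1 <= k < n.+1) clipped_mean k y 0 i) - grad F y 0 i).
  apply: measurable_funB; last exact: measurable_grad.
  apply: measurable_funM => //; apply: measurable_sum_nat => k /andP[k1 _].
  exact: measurable_clipped_mean.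
by apply/funext => y; rewrite /bias !mxE summxE.
Qed.

Lemma measurable_partial_error k i : (k <= n)%N ->
  measurable_fun (setT : set (history (past t k)))
    (fun w : history (past t k) => partial_error k w 0 i).
Proof.
move=> kn; have mx := @measurable_iterate_past k.
rewrite (_ : (fun _ => _) = fun w => bias (x t w) 0 i + n%:R^-1 *
  \sum_(1 <= j < k.+1) (clip (level j) (g (x t w) (xi t j w)) 0 i
                        - clipped_mean j (x t w) 0 i)); last first.
  apply/funext => w; rewrite /partial_error [LHS]mxE [X in _ + X]mxE summxE; congr (_ + _ * _).
  by apply: eq_bigr => j _; rewrite !mxE.
apply: measurable_funD; first exact: measurableT_comp (measurable_bias i) mx.
apply: measurable_funM => //; apply: measurable_sum_nat => j /andP[j1 jk].
apply: measurable_funB; last first.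
  exact: measurableT_comp (measurable_clipped_mean i j1) mx.
apply: measurable_clip; first exact: level_gt0.
move=> l; apply: measurable_oracle => //; apply: measurable_sample.
rewrite ltnS in jk; split; last by rewrite /= eqxx jk orbT.
by rewrite /in_range /= tT j1 (leq_trans jk).
Qed.

Lemma measurable_sqr_partial_error k : (k <= n)%N ->
  measurable_fun setT (fun w => enorm (partial_error k w) ^+ 2).
Proof.
move=> kn; apply: measurable_funX; apply: measurable_enorm => i.
exact: measurable_history (measurable_partial_error i kn).
Qed.

(** The index (t, k+1) lies outside [past t k], so this sample is independent of that history, and
    [integral_freeze] applies with the identity as Y. *)
Lemma integral_next_sample k (h : history (past t k) * Xi -> \bar R) :
  (k < n)%N -> measurable_fun setT h -> (forall z, 0 <= h z)%E ->
  (\int[P]_w h (w, xi t k.+1 w) = \int[P]_w \int[D]_z h (w, z))%E.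
Proof.
move=> kn mh h0; case: iid => same indep.
refine (@integral_freeze _ _ _ _ _ P _ (history (past t k)) D (xi t k.+1)
  (id : Omega -> history (past t k)) h _ _ _ mh h0) => //.
  by apply: (@measurable_history (past t k)); exact: measurable_id.
move=> A B mA mB; rewrite -(same t k.+1)//.
apply: (@independent_past _ _ _ _ _ P _ _ (past t k) xi' (t, k.+1) B A indep) => //.
- by move=> s [].
- by rewrite /= tT.
- by move=> [_] /=; rewrite ltnn eqxx ltnn.
Qed.

(** Induction on the number of samples: the bias bound holds at every point and starts it; each step
    integrates the newest sample first and adds its variance through [clip_noise]. *)
Lemma partial_error_moment k : (k <= n)%N ->
  (\int[P]_w (enorm (partial_error k w) ^+ 2)%:E <=
   ((p * sigma * n%:R `^ (p^-1 - 1)) ^+ 2 +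
    \sum_(1 <= j < k.+1)
      n%:R^-1 ^+ 2 * (level j `^ (2 - p) * sigma `^ p))%:E)%E.
Proof.
elim: k => [_|k IH kn].
  rewrite [X in _ + X]big_geq// addr0.
  set c := (_ ^+ 2 in leRHS).
  apply: (@le_trans _ _ (\int[P]_w (cst c%:E w))%E); last first.
    by rewrite integral_cst_probability.
  apply: ge0_le_integral => //.
  - by move=> w _; rewrite lee_fin sqr_ge0.
  - by apply/measurable_EFinP; exact: measurable_sqr_partial_error.
  move=> w _; rewrite lee_fin /partial_error big_geq// scaler0 addr0.
  have B0 := enorm_bias_le (x t w).
  by rewrite ler_sqr ?nnegrE ?enorm_ge0// (le_trans _ B0)// enorm_ge0.
(* The first argument of [h] carries all that the past determines, the second the new sample. *)
pose h (z : history (past t k) * Xi) : \bar R :=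
  (enorm (partial_error k z.1 + n%:R^-1 *:
     (clip (level k.+1) (g (x t z.1) z.2) - clipped_mean k.+1 (x t z.1))) ^+ 2)%:E.
have mx : measurable_fun setT
    ((x t : history (past t k) -> borel_rV R d) \o (@fst (history (past t k)) Xi)).
  exact: measurableT_comp (@measurable_iterate_past k) measurable_fst.
have mh : measurable_fun setT h.
  apply/measurable_EFinP; apply: measurable_funX; apply: measurable_enorm => i.
  rewrite (_ : (fun _ => _) = fun z : history (past t k) * Xi =>
    partial_error k z.1 0 i + n%:R^-1 *
    (clip (level k.+1) (g (x t z.1) z.2) 0 i - clipped_mean k.+1 (x t z.1) 0 i)).
    apply: measurable_funD.
      exact: measurableT_comp (measurable_partial_error i (ltnW kn)) measurable_fst.
    apply: measurable_funM => //; apply: measurable_funB; last first.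
      exact: measurableT_comp (measurable_clipped_mean i (ltn0Sn k)) mx.
    apply: measurable_clip; first exact: level_gt0.
    by move=> j; exact: measurable_oracle.
  by apply/funext => z; rewrite !mxE.
under eq_integral do rewrite partial_error_recr.
rewrite (integral_next_sample (h := h))//; last first.
  by move=> z; rewrite lee_fin sqr_ge0.
rewrite big_nat_recr//= addrA EFinD.
pose c := n%:R^-1 ^+ 2 * (level k.+1 `^ (2 - p) * sigma `^ p).
have c0 : 0 <= c by rewrite !mulr_ge0 ?sqr_ge0 ?powR_ge0.
apply: (@le_trans _ _
    (\int[P]_w ((enorm (partial_error k w) ^+ 2)%:E + cst c%:E w))%E); last first.
  rewrite ge0_integralD//.
  - by rewrite integral_cst_probability leeD2r// IH// ltnW.
  - by move=> w _; rewrite lee_fin sqr_ge0.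
  - by apply/measurable_EFinP; apply: measurable_sqr_partial_error; exact: ltnW.
apply: ge0_le_integral => //.
- by move=> w _; apply: integral_ge0 => z _; rewrite lee_fin sqr_ge0.
- apply: (@measurable_history (past t k)).
  by apply: measurable_fun_fubini_tonelli_F => // z; rewrite lee_fin sqr_ge0.
- apply: emeasurable_funD => //.
  by apply/measurable_EFinP; apply: measurable_sqr_partial_error; exact: ltnW.
move=> w _; have mg i := @measurable_oracle_at (x t w) i.
have := clip_noise mg p12 (oracle_moment (x t w)) (level_gt0 (ltn0Sn k))
  (partial_error k w) n%:R^-1.
by rewrite EFinD.
Qed.

Lemma estimator_error_moment :
  (\int[P]_w (enorm (ps_clip_estimator g sigma p n (x t w) (fun k => xi t k w)
                     - grad F (x t w)) ^+ 2)%:E <=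
   (5 * (sigma ^+ 2 * (n%:R `^ (p^-1 - 1)) ^+ 2))%:E)%E.
Proof.
under eq_integral do rewrite -partial_error_last.
rewrite (le_trans (partial_error_moment (leqnn n)))// lee_fin.
have := mean_variance_le p12 s0 n0; rewrite -/(level _).
set V := (X in X <= _ -> _) => VB.
(* The constant 5 is p^2 <= 4 from the squared bias plus 1 from the variance. *)
have p4 : p ^+ 2 <= 4 by case/andP: p12 => p1 p2; nra.
have := ler_wpM2r (mulr_ge0 (sqr_ge0 sigma) (sqr_ge0 (n%:R `^ (p^-1 - 1)))) p4.
rewrite !exprMn -mulrA; move: VB; rewrite /V; lra.
Qed.

Lemma measurable_sqr_grad :
  measurable_fun setT (fun w => enorm (grad F (x t w)) ^+ 2).
Proof.
apply: measurable_funX; apply: measurable_enorm => i.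
apply: (@measurable_history (past t 0)).
exact: measurableT_comp (measurable_grad i) (@measurable_iterate_past 0).
Qed.

Lemma measurable_sqr_estimator_error : measurable_fun setT (fun w =>
  enorm (ps_clip_estimator g sigma p n (x t w) (fun k => xi t k w)
         - grad F (x t w)) ^+ 2).
Proof.
under eq_fun do rewrite -partial_error_last.
exact: measurable_sqr_partial_error.
Qed.

End one_iteration.

(** * Summation over the iterations *)

Lemma sum_sqr_grad_le (L Fstar : R) w : 0 < L -> L_smooth L F ->
  (forall y, Fstar <= F y) -> (eta = fun=> 1 / (2 * L)) ->
  \sum_(1 <= t < T.+1) enorm (grad F (x t w)) ^+ 2 <=
    4 * L * (F x1 - Fstar) +
    \sum_(1 <= t < T.+1)
      enorm (ps_clip_estimator g sigma p n (x t w) (fun k => xi t k w)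
             - grad F (x t w)) ^+ 2.
Proof.
move=> L0 LF Fb etaE; case: sgd => x1E step.
apply: (@le_trans _ _ (4 * L * (F x1 - F (x T.+1 w)) +
    \sum_(1 <= t < T.+1)
      enorm (ps_clip_estimator g sigma p n (x t w) (fun k => xi t k w)
             - grad F (x t w)) ^+ 2)); last first.
  by rewrite lerD2r ler_wpM2l ?mulr_ge0 ?(ltW L0)// lerD2l lerN2.
have -> : F x1 - F (x T.+1 w) = \sum_(1 <= t < T.+1) (F (x t w) - F (x t.+1 w)).
  rewrite -(x1E w) -opprB -(@telescope_sumr _ 1 T.+1 (fun t => F (x t w)))//.
  by rewrite -sumrN; apply: eq_bigr => t _; rewrite opprB.
rewrite mulr_sumr -big_split/=; apply: ler_sum_nat => t tT.
rewrite step// etaE; apply: descent_step => //.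
by case: LF.
Qed.

(** The pathwise bound is integrated. All integrands are nonnegative, so sums and integrals are
    exchanged without integrability conditions. *)
Lemma avg_sq_grad_le (L Fstar : R) : 0 < L -> L_smooth L F ->
  (forall y, Fstar <= F y) -> (eta = fun=> 1 / (2 * L)) -> (0 < T)%N ->
  (avg_sq_grad P F T x <= (4 * (L * (F x1 - Fstar) / T%:R) +
     5 * (sigma ^+ 2 * (n%:R `^ (p^-1 - 1)) ^+ 2))%:E)%E.
Proof.
move=> L0 LF Fb etaE T0; rewrite /avg_sq_grad.
have EP (X : Omega -> R) : ('E_P[X] = \int[P]_w (X w)%:E)%E by rewrite unlock.
under eq_bigr do rewrite EP.
have T0' : 0 < T%:R :> R by rewrite ltr0n.
have Delta0 : 0 <= F x1 - Fstar by rewrite subr_ge0.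
rewrite lee_pdivrMl// -EFinM mulrDr.
rewrite [X in (_ <= (X + _)%:E)%E](_ : _ = 4 * L * (F x1 - Fstar)); last first.
  by field; rewrite gt_eqF.
pose e t w := enorm (ps_clip_estimator g sigma p n (x t w) (fun k => xi t k w)
  - grad F (x t w)) ^+ 2.
have in_T (t : 'I_T) : (1 <= t.+1 <= T)%N by rewrite ltn_ord.
rewrite big_add1 big_mkord -ge0_integral_sum//; last 2 first.
- by move=> t; apply/measurable_EFinP; exact: measurable_sqr_grad.
- by move=> t w _; rewrite lee_fin sqr_ge0.
apply: (@le_trans _ _ (\int[P]_w (cst (4 * L * (F x1 - Fstar))%:E w +
    \sum_(t < T) (e t.+1 w)%:E))%E).
  apply: ge0_le_integral => //.
  - by move=> w _; apply: sume_ge0 => t _; rewrite lee_fin sqr_ge0.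
  - apply: emeasurable_sum => t.
    by apply/measurable_EFinP; exact: measurable_sqr_grad.
  - apply: emeasurable_funD => //; apply: emeasurable_sum => t.
    by apply/measurable_EFinP; exact: measurable_sqr_estimator_error.
  move=> w _; rewrite /= !sumEFin -EFinD lee_fin.
  have := sum_sqr_grad_le w L0 LF Fb etaE.
  by rewrite !big_add1 !big_mkord.
have me (t : 'I_T) : measurable_fun setT (fun w => (e t.+1 w)%:E).
  by apply/measurable_EFinP; exact: measurable_sqr_estimator_error.
have e0 (t : 'I_T) w : (0 <= (e t.+1 w)%:E)%E by rewrite lee_fin sqr_ge0.
rewrite ge0_integralD//; last 3 first.
- by move=> w _; rewrite lee_fin !mulr_ge0// ltW.
- by move=> w _; apply: sume_ge0.
- by apply: emeasurable_sum => t.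
rewrite integral_cst_probability ge0_integral_sum//.
rewrite EFinD leeD2l//.
have -> (c : R) : T%:R * c = \sum_(t < T) c by rewrite sumr_const card_ord mulr_natl.
rewrite -sumEFin.
by apply: lee_sum => t _; exact: estimator_error_moment.
Qed.

End sgd.

(** The O-bound is stated for eps^2 <= K Delta_1 L with arbitrary K: at least one gradient is always
    used, while the claimed complexity tends to 0 as eps grows. C depends on p and K only, and T is
    chosen before the problem instance. *)
Theorem corollary3p2 (R : realType) (p : R) (hp : 1 < p <= 2) :
  (forall (L sigma Delta1 : R) (T : nat),
     0 < L -> 0 < sigma -> 0 < Delta1 -> (1 <= T)%N ->
   forall (d : nat) (F : 'rV[R]_d -> R) (Fstar : R) (x1 : 'rV[R]_d)
     (dX : measure_display) (Xi : measurableType dX) (D : probability Xi R)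
     (g : 'rV[R]_d -> Xi -> 'rV[R]_d)
     (dO : measure_display) (Omega : measurableType dO)
     (P : probability Omega R) (xi : nat -> nat -> {RV P >-> Xi})
     (x : nat -> Omega -> 'rV[R]_d),
     (1 <= d)%N ->
     L_smooth L F ->
     (forall y, Fstar <= F y) ->
     F x1 - Fstar = Delta1 ->
     stochastic_gradient_oracle F D p sigma g ->
     iid_samples D T (batch_size p L sigma Delta1 T) xi ->
     ps_clip_sgd g sigma p (batch_size p L sigma Delta1 T)
       (fun=> 1 / (2 * L)) x1 T (fun t k => xi t k) x ->
     (avg_sq_grad P F T x <= (9 * (Delta1 * L / T%:R))%:E)%E)
  /\
  (forall K : R, 0 < K ->
   exists C : R,
   forall L sigma Delta1 eps : R,
     0 < L -> 0 < sigma -> 0 < Delta1 -> 0 < eps ->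
     eps ^+ 2 <= K * (Delta1 * L) ->
   exists2 T : nat,
     (1 <= T)%N /\
     (batch_size p L sigma Delta1 T * T)%:R <=
       C * (Delta1 * L / eps ^+ 2 +
            Delta1 * L / eps ^+ 2 * (sigma / eps) `^ (p / (p - 1))) &
     forall (d : nat) (F : 'rV[R]_d -> R) (Fstar : R) (x1 : 'rV[R]_d)
       (dX : measure_display) (Xi : measurableType dX) (D : probability Xi R)
       (g : 'rV[R]_d -> Xi -> 'rV[R]_d)
       (dO : measure_display) (Omega : measurableType dO)
       (P : probability Omega R) (xi : nat -> nat -> {RV P >-> Xi})
       (x : nat -> Omega -> 'rV[R]_d),
       (1 <= d)%N ->
       L_smooth L F ->
       (forall y, Fstar <= F y) ->
       F x1 - Fstar = Delta1 ->
       stochastic_gradient_oracle F D p sigma g ->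
       iid_samples D T (batch_size p L sigma Delta1 T) xi ->
       ps_clip_sgd g sigma p (batch_size p L sigma Delta1 T)
         (fun=> 1 / (2 * L)) x1 T (fun t k => xi t k) x ->
       (avg_sq_grad P F T x < (eps ^+ 2)%:E)%E).
Proof.
have [p1 p2] := andP hp.
(* The rate is made available as a hypothesis for the complexity claim. *)
have and_imp (A B : Prop) : A -> (A -> B) -> A /\ B by move=> a; split; auto.
apply: and_imp => [L sigma Delta1 T L0 s0 D0 T0 d F Fstar x1 dX Xi D g dO
    Omega P xi x _ LF Fb DE oracle iid sgd|bound K K0].
  have n0 := batch_size_gt0 p L sigma Delta1 T.
  have := avg_sq_grad_le hp s0 n0 oracle iid sgd L0 LF Fb erefl T0.
  move=> /le_trans; apply; rewrite lee_fin DE (mulrC L).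
  (* Of the constant 9, the descent contributes 4 and the estimator error 5. *)
  have := batch_rate p1 L0 s0 D0 T0 (batch_size_ge p L sigma Delta1 T).
  lra.
pose e := p / (2 * (p - 1)).
have e0 : 0 <= e.
  by rewrite /e divr_ge0 ?mulr_ge0 ?subr_ge0 ?(ltW p1)// ltW// (lt_trans ltr01).
(* The factors come from T <= (9 + K) B and n <= 2 + (9 + K)^e y below. *)
exists ((9 + K) * (2 + (9 + K) `^ e)) => L sigma Delta1 eps L0 s0 D0 eps0 epsK.
pose B := Delta1 * L / eps ^+ 2.
have eps2 : 0 < eps ^+ 2 by rewrite exprn_gt0.
have B0 : 0 < B by rewrite divr_gt0 ?mulr_gt0.
have KB : 1 <= K * B by rewrite mulrA ler_pdivlMr ?mul1r.
have K9 : 0 < 9 + K by rewrite addr_gt0.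
(* Floor plus one exceeds 9 B, which makes the final inequality strict; the extra 1 is at most K
   B. *)
pose T := (Num.truncn (9 * B)).+1.
have TB : 9 * B < T%:R by exact: truncnS_gt.
have TK : T%:R <= (9 + K) * B.
  have : (Num.truncn (9 * B))%:R <= 9 * B by rewrite truncn_le// mulr_ge0// ltW.
  rewrite /T -natr1; lra.
have T0 : 0 < T%:R :> R by rewrite ltr0n.
exists T; last first.
  move=> d F Fstar x1 dX Xi D g dO Omega P xi x d1 LF Fb DE oracle iid sgd.
  have := bound L sigma Delta1 T L0 s0 D0 isT d F Fstar x1 dX Xi D g dO Omega P
    xi x d1 LF Fb DE oracle iid sgd.
  move=> /le_lt_trans; apply.
  rewrite lte_fin mulrA ltr_pdivrMr// (_ : 9 * (Delta1 * L) = eps ^+ 2 * (9 * B)).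
    by rewrite ltr_pM2l.
  by rewrite /B; field; rewrite gt_eqF.
split => //; rewrite -/B.
set y := (sigma / eps) `^ (p / (p - 1)).
have y0 : 0 <= y by exact: powR_ge0.
have sE : sigma ^+ 2 * T%:R / (Delta1 * L) <= (9 + K) * (sigma / eps) ^+ 2.
  rewrite ler_pdivrMr ?mulr_gt0//.
  have -> : (9 + K) * (sigma / eps) ^+ 2 * (Delta1 * L) =
      sigma ^+ 2 * ((9 + K) * B) by rewrite /B; field; rewrite gt_eqF.
  by rewrite ler_wpM2l ?sqr_ge0.
have nB : (batch_size p L sigma Delta1 T)%:R <= 2 + (9 + K) `^ e * y.
  rewrite (le_trans (batch_size_le _ _ _ _ _))// lerD2l -/e.
  (* Since 2 e = p/(p-1), the e-th power of (sigma/eps)^2 is [y]. *)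
  have -> : (9 + K) `^ e * y = ((9 + K) * (sigma / eps) ^+ 2) `^ e.
    rewrite powRM ?sqr_ge0 ?(ltW K9)// -(powR_mulrn 2) ?divr_ge0 ?ltW//.
    rewrite -powRrM /y; congr (_ * _ `^ _); rewrite /e.
    by field; rewrite subr_eq0 gt_eqF.
  apply: ge0_ler_powR => //; rewrite nnegrE.
    by rewrite ltW// divr_gt0 ?mulr_gt0 ?exprn_gt0.
  by rewrite mulr_ge0 ?sqr_ge0 ?(ltW K9).
have M0 : 0 <= (9 + K) `^ e by exact: powR_ge0.
rewrite natrM (le_trans (ler_pM _ _ nB TK))// ?ler0n//.
rewrite -subr_ge0.
set M := (9 + K) `^ e in M0 *.
have -> : (9 + K) * (2 + M) * (B + B * y) - (2 + M * y) * ((9 + K) * B) =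
   (9 + K) * B * (M + 2 * y) by ring.
by rewrite mulr_ge0 ?addr_ge0 ?(mulr_ge0 _ y0)// ltW// mulr_gt0.
Qed.
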